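(* Let $X$ be a Banach space over $\mathbb{K}=\mathbb{R}$ or $\mathbb{C}$. Suppose that $$\mathcal{L}(X)=\mathbb{K}I_X+\mathcal{SS}(X)$$ and that, for some positive integer $m$, $S^m\in\mathcal{K}(X)$ for every $S\in\mathcal{SS}(X)$. If $X$ fails the bounded compact approximation property, then $X$ has the Lotz property.
   Context: $\mathcal{L}(X)$, $\mathcal{K}(X)$ and $\mathcal{SS}(X)$ denote the bounded, compact and strictly singular linear operators on $X$. An operator $S\in\mathcal{L}(X)$ is strictly singular if no restriction of $S$ to an infinite-dimensional closed subspace of $X$ is an isomorphism onto its range. $X$ has the bounded compact approximation property (BCAP) if there is a constant $C\ge 1$ such that for every compact set $D\subset X$ and every $\varepsilon>0$ there is $K\in\mathcal{K}(X)$ with $\|K\|\le C$ and $\sup_{x\in D}\|Kx-x\|<\varepsilon$. A $C_0$-semigroup on $X$ is a family $(T(t))_{t\ge 0}\subset\mathcal{L}(X)$ with $T(0)=I_X$, $T(t+s)=T(t)T(s)$ for $t,s\ge 0$, and $\lim_{t\downarrow 0}\|T(t)x-x\|=0$ for every $x\in X$. It is uniformly continuous if $\lim_{t\downarrow 0}\|T(t)-I_X\|=0$. $X$ has the Lotz property if every $C_0$-semigroup on $X$ is uniformly continuous. *)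

(* Defs.v *)
From HB Require Import structures.
From mathcomp Require Import all_boot all_order all_algebra.
From mathcomp Require Import complex.
From mathcomp Require Import all_classical all_reals all_analysis.

Set Implicit Arguments.
Unset Strict Implicit.
Unset Printing Implicit Defensive.

Import Order.TTheory GRing.Theory Num.Theory.
Import numFieldNormedType.Exports.

Local Open Scope classical_set_scope.
Local Open Scope ring_scope.

(* The scalar field K is an arbitrary numFieldType so that the definitions
   cover both a realType R and its complexification R[i]. Norms take values in
   K; over R[i] they are real elements, since x <= y in R[i] means that y - x
   is real and nonnegative. Thus 1 <= C or 0 < e force C and e to be real, and
   the supremum in the partial order of R[i] of a nonempty bounded set of real
   elements is its usual real supremum. *)

Section Operators.
Context {K : numFieldType} {X : normedModType K}.
Implicit Types (A S : X -> X) (M D : set X).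

Definition unit_ball : set X := [set x | `|x| <= 1].

Definition bounded_operators : set (X -> X) :=
  [set A | linear A /\ [bounded A x | x in unit_ball]].

Definition opnorm A : K := supremum 0 [set `|A x| | x in unit_ball].

Definition compact_operators : set (X -> X) :=
  [set A | bounded_operators A /\ precompact (A @` unit_ball)].

Definition is_subspace M :=
  M 0 /\ forall (a : K) (x y : X), M x -> M y -> M (a *: x + y).

Definition finite_dimensional M :=
  exists (n : nat) (v : 'I_n -> X),
    M = [set \sum_(i < n) a i *: v i | a in [set: 'I_n -> K]].

(* The restriction of the bounded operator S to M is injective and its inverse
   S @` M -> M, represented by G, is continuous. *)
Definition isomorphism_onto_range_on M S :=
  exists G : X -> X,
    (forall x, M x -> G (S x) = x) /\ {within S @` M, continuous G}.

Definition strictly_singular_operators : set (X -> X) :=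
  [set S | bounded_operators S /\
     forall M, is_subspace M -> closed M -> ~ finite_dimensional M ->
       ~ isomorphism_onto_range_on M S].

End Operators.

Arguments bounded_operators {K} X.
Arguments compact_operators {K} X.
Arguments strictly_singular_operators {K} X.

Definition BCAP (K : numFieldType) (X : normedModType K) :=
  exists C : K, 1 <= C /\
    forall (D : set X) (e : K), compact D -> 0 < e ->
      exists A : X -> X, [/\ compact_operators X A, opnorm A <= C &
        supremum 0 [set `|A x - x| | x in D] < e].

(* Only the values T t with 0 <= t matter. *)
Definition C0_semigroup (R : realType) (K : numFieldType) (X : normedModType K)
    (T : R -> X -> X) :=
  [/\ forall t, 0 <= t -> bounded_operators X (T t),
      T 0 = id,
      forall t s, 0 <= t -> 0 <= s -> T (t + s) = T t \o T s &
      forall x : X, `|T t x - x| @[t --> 0^'+] --> (0 : K)].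

Definition uniformly_continuous_semigroup (R : realType) (K : numFieldType)
    (X : normedModType K) (T : R -> X -> X) :=
  opnorm (fun x => T t x - x) @[t --> 0^'+] --> (0 : K).

Definition Lotz_property (R : realType) (K : numFieldType)
    (X : normedModType K) :=
  forall T : R -> X -> X, C0_semigroup T -> uniformly_continuous_semigroup T.

(* Main.v *)
Require Import Defs.
From HB Require Import structures.
From mathcomp Require Import all_boot all_order all_algebra.
From mathcomp Require Import complex.
From mathcomp Require Import all_classical all_reals all_analysis.
From mathcomp Require Import ring lra.
Import Order.TTheory GRing.Theory Num.Theory.
Import numFieldNormedType.Exports.
Local Open Scope classical_set_scope.
Local Open Scope ring_scope.
(** Why the theorem is true. Write T(t) = a(t) I + S(t) with S(t) strictly
    singular, so that S(t)^m is compact, and B(t) = T(t) - I.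

    The scalars a(t) tend to 1 as t decreases to 0 ([coefficient_cvg1]).
    Otherwise there are t_n decreasing to 0 with |a(t_n) - 1| > h, and the
    operators
      K_n = (I + (1 - a(t_n))^-1 B(t_n))^m = (1 - a(t_n))^-m S(t_n)^m
    are compact by the second formula, while the first one shows that they are
    bounded uniformly in n and converge strongly, hence uniformly on compact
    sets, to I. That is the bounded compact approximation property.

    It remains to see that the norm of B(s) tends to 0 as s decreases to 0. It
    is enough to show that a bound b on this norm for small s improves to
    7/8 b for smaller s ([incr_contraction]). For fixed small t, the operator
    S(t)^m is compact and B(s) tends to 0 strongly, so B(s) S(t)^m tends to 0
    in norm; moreover B(t)^m differs from S(t)^m by a constant times |a(t) - 1|.
    Hence B(s) B(t)^m has norm at most 3/4 b once s is small enough, how small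
    depending on t. By the Baire theorem on the time axis this dependence
    disappears for t in some segment [p, q]. Now expand
      B(t)^m = (-1)^m I + sum over 1 <= j <= m of c_j T(j t)
    and average B(s) B(t)^m over many times t in [p, q] in arithmetic
    progression with step s / m!. For j >= 1 the sum of the B(s) T(j t)
    telescopes, so its average is small, and what is left is
    (-1)^m B(s), whose norm is therefore at most 3/4 b plus an arbitrarily small
    error ([incr_bounded_of_average]). Averaging finite sums takes the place of
    integrating the semigroup.

    Both scalar fields are handled at once: the norm takes values in the field K,
    and [real_part R K] records what is needed to replace it by a real number. *)

(** * Real-valued norms over a field with real part *)

(** The field K is R or R[i]: norms in K are images of real numbers. *)
Record real_part (R : realType) (K : numFieldType) := RealPart {
  emb :> {rmorphism R -> K};
  re : K -> R;
  emb_le : forall x y, (emb x <= emb y) = (x <= y);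
  emb_re : forall z, 0 <= z -> emb (re z) = z }.
Arguments emb_le {R K}.
Arguments emb_re {R K}.
Arguments re {R K}.

Definition rnorm {R : realType} {K : numFieldType} (E : real_part R K)
  {V : normedZmodType K} (x : V) : R := re E `|x|.

Definition bounded_by {R : realType} {K : numFieldType} (E : real_part R K)
  {V : normedZmodType K} (c : R) (A : V -> V) :=
  forall x, rnorm E (A x) <= c * rnorm E x.

Section RealNorm.
Context {R : realType} {K : numFieldType} (E : real_part R K).
Local Notation N := (rnorm E).

Lemma emb_lt x y : (E x < E y) = (x < y).
Proof. by rewrite !lt_neqAle emb_le (inj_eq (fmorph_inj _)). Qed.

Lemma emb_ge0 x : (0 <= E x) = (0 <= x).
Proof. by rewrite -(rmorph0 E) emb_le. Qed.

Lemma emb_gt0 x : (0 < E x) = (0 < x).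
Proof. by rewrite -(rmorph0 E) emb_lt. Qed.

Lemma re_emb x : 0 <= x -> re E (E x) = x.
Proof. by move=> x0; apply: (fmorph_inj E); rewrite emb_re// emb_ge0. Qed.

Lemma re_gt0 e : 0 < e -> 0 < re E e.
Proof. by move=> e0; rewrite -emb_gt0 emb_re// ltW. Qed.

Section Group.
Context {V : normedZmodType K}.
Implicit Types x y : V.

Lemma normE x : `|x| = E (N x).
Proof. by rewrite emb_re. Qed.

Lemma rnorm_ge0 x : 0 <= N x.
Proof. by rewrite -emb_ge0 -normE. Qed.

Lemma rnorm0 : N (0 : V) = 0.
Proof. by apply: (fmorph_inj E); rewrite -normE normr0 rmorph0. Qed.

Lemma rnormN x : N (- x) = N x.
Proof. by rewrite /rnorm normrN. Qed.

Lemma rnorm_distC x y : N (x - y) = N (y - x).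
Proof. by rewrite /rnorm distrC. Qed.

Lemma ler_rnormD x y : N (x + y) <= N x + N y.
Proof. by rewrite -(emb_le E) rmorphD /= -!normE ler_normD. Qed.

Lemma ler_rnormB x y : N (x - y) <= N x + N y.
Proof. by rewrite (le_trans (ler_rnormD _ _))// rnormN. Qed.

Lemma ler_rnorm_dist z x y : N (x - y) <= N (x - z) + N (z - y).
Proof. by rewrite -[x - y](subrKA z) ler_rnormD. Qed.

Lemma ler_rnorm_sum (I : Type) (r : seq I) (P : pred I) (F : I -> V) :
  N (\sum_(i <- r | P i) F i) <= \sum_(i <- r | P i) N (F i).
Proof.
elim/big_ind2 : _ => //; first by rewrite rnorm0.
by move=> a b c d ac bd; rewrite (le_trans (ler_rnormD _ _))// lerD.
Qed.

End Group.

Lemma rnorm_emb (a : R) : 0 <= a -> N (E a) = a.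
Proof. by move=> a0; rewrite /rnorm ger0_norm ?emb_ge0// re_emb. Qed.

Lemma rnormV (a : K) : N a^-1 = (N a)^-1.
Proof. by apply: (fmorph_inj E); rewrite fmorphV /= -!normE normfV. Qed.

Lemma rnorm_eq0 {V : normedZmodType K} (x : V) : (N x == 0) = (x == 0).
Proof. by rewrite -(inj_eq (fmorph_inj E)) -normE rmorph0 normr_eq0. Qed.

Section Module.
Context {X : normedModType K}.
Implicit Types (x y : X) (A B : X -> X).

Lemma rnormZ (a : K) x : N (a *: x) = N a * N x.
Proof. by apply: (fmorph_inj E); rewrite rmorphM /= -!normE normrZ. Qed.

Lemma near_rnorm x (e : R) : 0 < e -> \forall y \near x, N (y - x) < e.
Proof.
move=> e0; have : 0 < E e by rewrite emb_gt0.
move/(nbhsx_ballx x); apply: filterS => y.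
by rewrite -ball_normE /= normE emb_lt rnorm_distC.
Qed.

Lemma linear_D A : linear A -> forall x y, A (x + y) = A x + A y.
Proof. by move=> lA x y; rewrite -[x in LHS]scale1r lA scale1r. Qed.

Lemma linear_0 A : linear A -> A 0 = 0.
Proof. by move=> lA; apply: (addrI (A 0)); rewrite -linear_D// !addr0. Qed.

Lemma linear_Z A : linear A -> forall a x, A (a *: x) = a *: A x.
Proof. by move=> lA a x; rewrite -[a *: x]addr0 lA linear_0// addr0. Qed.

Lemma linear_N A : linear A -> forall x, A (- x) = - A x.
Proof. by move=> lA x; rewrite -scaleN1r linear_Z// scaleN1r. Qed.

Lemma linear_B A : linear A -> forall x y, A (x - y) = A x - A y.
Proof. by move=> lA x y; rewrite linear_D// linear_N. Qed.

Lemma linear_sum A (I : Type) (r : seq I) (F : I -> X) : linear A ->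
  A (\sum_(i <- r) F i) = \sum_(i <- r) A (F i).
Proof.
by move=> lA; elim/big_rec2 : _ => [|i x y _ <-]; [exact: linear_0|rewrite linear_D].
Qed.

Lemma linear_iter A n : linear A -> linear (iter n A).
Proof. by move=> lA; elim: n => [//|n IH] a x y; rewrite !iterS IH lA. Qed.

Lemma bounded_byW c d A : c <= d -> bounded_by E c A -> bounded_by E d A.
Proof. by move=> cd bA x; rewrite (le_trans (bA x))// ler_wpM2r ?rnorm_ge0. Qed.

Lemma bounded_by_iter c A n : 0 <= c -> bounded_by E c A ->
  bounded_by E (c ^+ n) (iter n A).
Proof.
move=> c0 bA; elim: n => [|n IH] x; first by rewrite expr0 mul1r.
by rewrite iterS exprS -mulrA (le_trans (bA _))// ler_wpM2l.
Qed.

Lemma unit_ballE x : unit_ball x <-> N x <= 1.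
Proof. by rewrite /unit_ball /= normE -(rmorph1 E) emb_le. Qed.

Lemma ball_bounded_by c A : linear A ->
  (forall x, N x <= 1 -> N (A x) <= c) -> bounded_by E c A.
Proof.
move=> lA bA x; have [->|x0] := eqVneq x 0; first by rewrite linear_0// rnorm0 mulr0.
have Nx0 : 0 < N x by rewrite lt_neqAle eq_sym rnorm_eq0 x0 rnorm_ge0.
have Ni : N (E (N x)^-1) = (N x)^-1 by rewrite rnorm_emb// invr_ge0 rnorm_ge0.
have /bA : N (E (N x)^-1 *: x) <= 1 by rewrite rnormZ Ni mulVf// gt_eqF.
by rewrite linear_Z// rnormZ Ni mulrC ler_pdivrMr.
Qed.

Lemma bounded_operator_by A : bounded_operators X A ->
  exists2 c, 0 <= c & bounded_by E c A.
Proof.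
case=> lA bA.
have [M M0 bM] : exists2 M : K, 0 < M & forall x, unit_ball x -> `|A x| <= M.
  have [M [M0 hM]] := pinfty_ex_gt0 bA.
  by exists M => // x /hM.
exists (re E M); first by rewrite ltW// re_gt0.
apply: ball_bounded_by => // x /unit_ballE/bM.
by rewrite normE -{1}(emb_re E M (ltW M0)) emb_le.
Qed.

Lemma bounded_by_operator c A : linear A -> bounded_by E c A ->
  bounded_operators X A.
Proof.
move=> lA bA; split => //.
exists (E `|c|); split; first by rewrite ger0_real// emb_ge0.
move=> M cM x /= /unit_ballE x1; apply: le_trans (ltW cM).
rewrite normE emb_le (le_trans (bA x))//.
by rewrite (le_trans (ler_wpM2r (rnorm_ge0 x) (ler_norm c)))// ler_piMr.
Qed.

(** In the partial order of K a bounded set need not have a supremum, and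
    [supremum 0] would then be 0. Nonnegative elements of K are real, so the
    completeness of R provides the supremum here. *)
Lemma supremum_emb_bounds (S : set K) (c : R) : 0 <= c ->
  (forall z, S z -> 0 <= z /\ z <= E c) ->
  0 <= supremum 0 S <= E c.
Proof.
move=> c0 Sc; have [->|] := eqVneq S set0; first by rewrite supremum0 lexx emb_ge0.
move=> /[dup] Sn0 /set0P [z0 Sz0].
have reS z : S z -> E (re E z) = z by move=> /Sc[z_ge0 _]; rewrite emb_re.
have hS : has_sup (re E @` S).
  split; first by exists (re E z0), z0.
  by exists c => _ [z Sz <-]; rewrite -(emb_le E) reS//; case: (Sc z Sz).
have : supremums S (supremum 0 S).
  rewrite /supremum (negPf Sn0); apply: xgetPex; exists (E (sup (re E @` S))); split.
    move=> z Sz; rewrite -(reS z Sz) emb_le.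
    by apply: ub_le_sup; [case: hS|exists z].
  move=> u uS; have u0 : 0 <= u by rewrite (le_trans _ (uS _ Sz0))//; case: (Sc _ Sz0).
  rewrite -(emb_re E u u0) emb_le; apply: ge_sup; first by case: hS.
  by move=> _ [z Sz <-]; rewrite -(emb_le E) reS// emb_re// uS.
case=> ub lb; apply/andP; split.
  by rewrite (le_trans _ (ub _ Sz0))//; case: (Sc _ Sz0).
by apply: lb => z /Sc[].
Qed.

End Module.
End RealNorm.
(** * Uniform boundedness and uniform convergence on compact sets *)

Section UniformBoundedness.
Context {R : realType} {K : numFieldType} (E : real_part R K).
Context {X : completeNormedModType K}.
Local Notation N := (rnorm E).
Local Notation bounded_by := (bounded_by E).

Lemma nested_limit (x : nat -> X) (r : nat -> R) :
  (forall n k, N (x (n + k)%N - x n) <= r n) ->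
  (forall e, 0 < e -> exists n, r n < e) ->
  exists z, forall n, N (z - x n) <= r n.
Proof.
move=> xr r0; have xc : cauchy (x @ \oo).
  apply: cauchy_exP => e e0; have [n rn] := r0 _ (re_gt0 E _ e0).
  exists (x n); exists n => // k /= nk; rewrite -ball_normE /= (normE E).
  rewrite -(emb_re E e (ltW e0)) emb_lt rnorm_distC -(subnKC nk).
  exact: le_lt_trans (xr _ _) rn.
have /cvg_ex[l xl] : cvg (x @ \oo) by exact: cauchy_cvg.
exists l => n; apply/ler_addgt0Pr => e e0.
have [k _] := xl _ (near_rnorm E l e e0).
move=> /(_ (n + k)%N (leq_addl _ _)) ke.
by rewrite (le_trans (ler_rnorm_dist E (x (n + k)%N) _ _))// addrC lerD// rnorm_distC ltW.
Qed.

(** Gliding hump. Without a uniform bound, every ball contains a smaller ball on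
    which some A i is at least n; nested balls of this kind, one for each n, meet
    in a point at which the A i are unbounded. *)
Lemma uniform_boundedness (A : nat -> X -> X) :
  (forall i, linear (A i)) -> (forall i, exists2 c, 0 <= c & bounded_by c (A i)) ->
  (forall x, exists M, forall i, N (A i x) <= M) ->
  exists M, forall i, bounded_by M (A i).
Proof.
move=> lA bA pA; apply: contrapT => nuA.
pose hop n (p q : X * R) := 0 < p.2 ->
  [/\ N (q.1 - p.1) <= p.2, 0 < q.2, 2 * q.2 <= p.2 &
    exists i, forall z, N (z - q.1) <= 2 * q.2 -> n%:R <= N (A i z)].
have escape n p : exists q, hop n p q.
  rewrite {}/hop.
  have [r0|r0] := pselect (0 < p.2); last by exists p.
  case: p r0 => x r /= r0.
  have [i [y0 Ay0]] : exists i y, n.+1%:R / r * N y < N (A i y).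
    apply: contrapT => nA; apply: nuA; exists (n.+1%:R / r) => i y.
    by rewrite leNgt; apply/negP => Ay; apply: nA; exists i, y.
  have Ny0 : 0 < N y0.
    rewrite lt_neqAle eq_sym rnorm_eq0 rnorm_ge0 andbT; apply/eqP => y00.
    by move: Ay0; rewrite y00 linear_0// !rnorm0 mulr0 ltxx.
  have a0 : 0 <= r / N y0 by rewrite divr_ge0// ltW.
  pose y := E (r / N y0) *: y0.
  have Ny : N y = r by rewrite rnormZ rnorm_emb// divfK ?gt_eqF.
  have Ay : n.+1%:R < N (A i y).
    rewrite linear_Z// rnormZ rnorm_emb// mulrAC ltr_pdivlMr// -ltr_pdivrMl//.
    by rewrite mulrA [_^-1 * _]mulrC.
  have [x' [xx' Ax']] : exists x', N (x' - x) <= r /\ n.+1%:R < N (A i x').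
    have [?|le1] := ltP n.+1%:R (N (A i (x + y))).
      by exists (x + y); rewrite addrC addKr Ny.
    exists (x - y); rewrite addrC addKr rnormN Ny; split=> //.
    have : N (A i y + A i y) <= N (A i (x + y)) + N (A i (x - y)).
      rewrite -linear_D// (_ : y + y = (x + y) - (x - y)); last first.
        by rewrite opprB [RHS]addrC subrKA.
      by rewrite linear_B// ler_rnormB.
    have -> : A i y + A i y = E 2 *: A i y by rewrite rmorph_nat scaler_nat.
    by rewrite rnormZ rnorm_emb//; lra.
  have [c c0 bc] := bA i.
  have c1 : 0 < 2 * (c + 1) by lra.
  (* The second bound makes A i vary by at most 1 on the ball of radius
     2 r' about x', so it stays at least n there. *)
  pose r' := Num.min (r / 2) (2 * (c + 1))^-1.
  exists (x', r') => _ /=; split => //.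
  - by rewrite lt_min invr_gt0 c1 andbT; lra.
  - by have : r' <= r / 2 by [rewrite ge_min lexx]; lra.
  exists i => z zx.
  have r'c : c * (2 * r') <= 1.
    have : r' <= (2 * (c + 1))^-1 by rewrite ge_min lexx orbT.
    rewrite -[leRHS]mul1r ler_pdivlMr// => h.
    have : 0 < r' by rewrite lt_min invr_gt0 c1 andbT; lra.
    by move: h; nra.
  have := le_trans (bc (z - x')) (ler_wpM2l c0 zx).
  have := ler_rnormB E (A i z) (A i (z - x')).
  rewrite linear_B// subKr; move: Ax'; rewrite -natr1.
  by lra.
have [f fP] : exists f, forall n p, hop n p (f n p).
  exists (fun n => projT1 (choice (escape n))) => n.
  exact: (projT2 (choice (escape n))).
pose p := fix p n := if n is k.+1 then f k (p k) else (0 : X, 1 : R).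
have pS n : p n.+1 = f n (p n) by [].
have p0 n : 0 < (p n).2.
  by elim: n => [|n IH]; [exact: ltr01|rewrite pS; have [] := fP n _ IH].
have pP n := fP n _ (p0 n).
(* The radii at least halve, so the later centres stay within 2 r_n. *)
have pk n k : N ((p (n + k)%N).1 - (p n).1) <= 2 * ((p n).2 - (p (n + k)%N).2).
  elim: k => [|k IH]; first by rewrite addn0 !subrr rnorm0 mulr0.
  have [] := pP (n + k)%N; rewrite -pS -addnS => h1 h2 h3 _.
  have := ler_rnorm_dist E (p (n + k)%N).1 (p (n + k.+1)%N).1 (p n).1.
  by lra.
have pn n : (p n).2 * 2 ^+ n <= 1.
  elim: n => [|n IH]; first by rewrite mulr1.
  have [_ _] := pP n; rewrite -pS => h _; rewrite exprS mulrCA mulrA.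
  by apply: le_trans IH; rewrite ler_pM2r// exprn_gt0.
have [z zP] : exists z, forall n, N (z - (p n).1) <= 2 * (p n).2.
  apply: nested_limit => [n k|e e0].
    by apply: le_trans (pk n k) _; have := p0 (n + k)%N; lra.
  pose n := (Num.truncn (2 / e)).+1; exists n.
  have : 2 / e < n%:R by exact: truncnS_gt.
  have : n%:R <= 2 ^+ n :> R by rewrite -natrX ler_nat ltnW// ltn_expl.
  move=> h1 h2; have {h1 h2} : 2 / e < 2 ^+ n by exact: lt_le_trans h2 h1.
  rewrite ltr_pdivrMr// => h; have := pn n; have := p0 n.
  have : 0 < 2 ^+ n :> R by rewrite exprn_gt0.
  move: (2 ^+ n) h => q h q0 r0 rq.
  by rewrite -(ltr_pM2r q0); nra.
have [M hM] := pA z; have [_ _ _ [i /(_ z)]] := pP (Num.truncn M).+1.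
rewrite -pS => /(_ (zP _)); apply/negP; rewrite -ltNge.
by rewrite (le_lt_trans (hM i))// truncnS_gt.
Qed.

(** Telescoping A^n - I = sum of A^i (A - I) transfers strong convergence to I
    from operators to their powers. *)
Lemma iter_near_id k n (A : X -> X) x : 1 <= k -> linear A -> bounded_by k A ->
  N (iter n A x - x) <= n%:R * k ^+ n * N (A x - x).
Proof.
move=> k1 lA bA; have k0 : 0 <= k by exact: le_trans k1.
elim: n => [|n IH]; first by rewrite subrr rnorm0 !mul0r.
rewrite iterSr -natr1 (le_trans (ler_rnorm_dist E (iter n A x) _ _))//.
rewrite -linear_B; last exact: linear_iter.
apply: le_trans (lerD (bounded_by_iter E k A n k0 bA (A x - x)) IH) _.
rewrite -mulrDl -[X in X + _]mul1r -mulrDl [1 + _]addrC ler_wpM2r ?rnorm_ge0//.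
by rewrite ler_wpM2l// ?addr_ge0// ler_weXn2l.
Qed.

Lemma iter_perturb k h n (A S : X -> X) (a : K) x : 0 <= k -> h <= 1 ->
  linear A -> bounded_by k A -> N a <= h -> (forall y, S y = a *: y + A y) ->
  N (iter n S x - iter n A x) <= n%:R * (k + 1) ^+ n * h * N x.
Proof.
move=> k0 h1 lA bA ah SE; have a0 := rnorm_ge0 E a.
elim: n => [|n IH]; first by rewrite subrr rnorm0 !mul0r.
rewrite !iterS; set y := iter n S x in IH *; set z := iter n A x in IH *.
have bz : N z <= (k + 1) ^+ n * N x.
  apply: (bounded_by_iter E (k + 1)); first by lra.
  by move=> u; have := bA u; have := rnorm_ge0 E u; lra.
have -> : S y - A z = a *: (y - z) + A (y - z) + a *: z.
  by rewrite SE (linear_B A lA) scalerBr [RHS]addrAC subrK addrA.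
have d1 : N (a *: (y - z) + A (y - z)) <= (k + 1) * N (y - z).
  rewrite (le_trans (ler_rnormD E _ _))// mulrDl mul1r addrC lerD ?bA// rnormZ.
  by rewrite ler_piMl ?rnorm_ge0// (le_trans ah).
have d2 : N (a *: z) <= (k + 1) * (h * ((k + 1) ^+ n * N x)).
  rewrite rnormZ; apply: le_trans (ler_pM a0 (rnorm_ge0 E _) ah bz) _.
  rewrite ler_peMl ?lerDr// !mulr_ge0 ?exprn_ge0 ?rnorm_ge0//; lra.
rewrite (le_trans (ler_rnormD E _ _))// (le_trans (lerD d1 d2))// -mulrDr -natr1 exprS.
rewrite -!mulrA [leRHS]mulrCA ler_wpM2l//; first by lra.
rewrite [leRHS]mulrDl mul1r lerD//; last by rewrite mulrCA.
by rewrite (le_trans IH)// !mulrA.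
Qed.

Lemma opnorm_bounds c (A : X -> X) : 0 <= c -> bounded_by c A -> 0 <= opnorm A <= E c.
Proof.
move=> c0 bA; apply: supremum_emb_bounds => // _ [x /(unit_ballE E) x1 <-].
rewrite normr_ge0 (normE E) emb_le; split => //.
by rewrite (le_trans (bA x))// ler_piMr.
Qed.

(** Near x, the operators A i move points by at most M times their distance, so
    smallness at x spreads to a neighbourhood; compactness does the rest. *)
Lemma uniform_on_compact (I : Type) (F : set_system I) (A : I -> X -> X) (M : R)
    (D : set X) (e : R) : Filter F ->
  (\forall i \near F, linear (A i) /\ bounded_by M (A i)) ->
  (forall x e', 0 < e' -> \forall i \near F, N (A i x) <= e') ->
  compact D -> 0 < e ->
  \forall i \near F, forall x, D x -> N (A i x) <= e.
Proof.
move=> FF bA A0 /compact_near_coveringP cD e0.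
apply: (cD I F (fun i x => N (A i x) <= e)) => x Dx.
have e2 : 0 < e / 2 by lra.
have M1 : 0 < `|M| + 1 by rewrite ltr_wpDl.
have d0 : 0 < e / 2 / (`|M| + 1) by rewrite divr_gt0.
near=> y i.
have [li bi] : linear (A i) /\ bounded_by M (A i) by near: i.
have xi : N (A i x) <= e / 2 by near: i; exact: A0.
have yx : N (y - x) < e / 2 / (`|M| + 1) by near: y; exact: near_rnorm.
have h : N (A i (y - x)) <= e / 2.
  apply: (le_trans (bi _)); move: yx; rewrite ltr_pdivlMr// => yx.
  have := rnorm_ge0 E (y - x); have := ler_norm M; nra.
rewrite -(subrK x y) linear_D// (le_trans (ler_rnormD E _ _))//.
by lra.
Unshelve. all: by end_near. Qed.

End UniformBoundedness.
(** * Two tools on the time axis *)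

Lemma right0P (R : realType) (P : R -> Prop) :
  (\forall s \near 0^'+, P s) <-> exists2 d, 0 < d & forall s, 0 < s < d -> P s.
Proof.
split=> [[d /= d0 dP]|[d d0 dP]].
  exists d => // s /andP[s0 sd]; apply: dP => //=.
  by rewrite sub0r normrN gtr0_norm.
near=> s; apply: dP; apply/andP; split; near: s.
  exact: nbhs_right_gt.
exact: nbhs_right_lt.
Unshelve. all: by end_near. Qed.

(** The two windows of length n, shifted by q, overlap except for q terms at each
    end. This is the discrete form of the fact that differences of translates
    have small averages: the right side has q terms, however large n is. *)
Lemma sum_shift_diff (V : zmodType) (f : nat -> V) n q :
  \sum_(k < n) (f (k + q)%N - f k) = \sum_(j < q) (f (n + j)%N - f j).
Proof.
elim: q => [|q IH]; first by rewrite big_ord0 big1// => k _; rewrite addn0 subrr.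
rewrite big_ord_recr /= -IH.
rewrite -[in RHS](_ : \sum_(k < n) (f (k.+1 + q)%N - f (k + q)%N) = f (n + q)%N - f q).
  by rewrite -big_split; apply: eq_bigr => k _ /=; rewrite addnS addSn addrC subrKA.
rewrite -(big_mkord xpredT (fun k => f (k.+1 + q)%N - f (k + q)%N)).
exact: (telescope_sumr (fun k => f (k + q)%N)).
Qed.

Lemma baire_segment (R : realType) (a b : R) (P : nat -> R -> Prop) : a < b ->
  (forall n, closed [set t | a <= t <= b /\ P n t]) ->
  (forall t, a <= t <= b -> exists n, P n t) ->
  exists n c d, [/\ a <= c, c < d, d <= b & forall t, c <= t <= d -> P n t].
Proof.
move=> ab cP covP; pose F n := ~` [set t | a <= t <= b /\ P n t].
have [n nF] : exists n, ~ dense (F n).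
  apply: contrapT => /forallNP dF.
  have /Baire/(_ `]a, b[%classic) : forall n, open (F n) /\ dense (F n).
    by move=> n; split; [rewrite openC; exact: cP|exact: contrapT].
  case=> [|//|t [/= tab tF]]; first exists ((a + b) / 2).
    by rewrite /= in_itv /=; apply/andP; split; lra.
  have tab' : a <= t <= b by move: tab; rewrite in_itv /= => /andP[? ?]; rewrite !ltW.
  by have [n nt] := covP t tab'; exact: tF n I (conj tab' nt).
have [U [[t Ut] oU UF]] : exists U : set R,
    [/\ U !=set0, open U & forall t, U t -> a <= t <= b /\ P n t].
  move: nF => /existsNP[U /not_implyP[U0 /not_implyP[oU UF]]].
  exists U; split => // t Ut; apply: contrapT => Ft; apply: UF.
  by exists t.
have [e /= e0 eU] : nbhs t U by exact: open_nbhs_nbhs.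
exists n, (t - e / 2), (t + e / 2).
have inU u : t - e / 2 <= u <= t + e / 2 -> U u.
  by move=> h; apply: eU => /=; rewrite ltr_norml; apply/andP; split; lra.
split; try lra.
- by have [] := UF (t - e / 2) (inU _ _); lra.
- by have [] := UF (t + e / 2) (inU _ _); lra.
by move=> u /inU/UF[].
Qed.
(** * Strongly continuous semigroups and their increments *)

Section Semigroup.
Context {R : realType} {K : numFieldType} (E : real_part R K).
Context {X : completeNormedModType K}.
Local Notation N := (rnorm E).
Local Notation bounded_by := (bounded_by E).
Context (T : R -> X -> X) (C0 : C0_semigroup T).

Implicit Types (s t u v e : R) (x y z : X).

Lemma semigroup_op t : 0 <= t -> bounded_operators X (T t).
Proof. by case: C0 => + _ _ _; exact. Qed.

Lemma semigroup_linear t : 0 <= t -> linear (T t).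
Proof. by move=> /semigroup_op[]. Qed.

Lemma semigroup0 x : T 0 x = x.
Proof. by case: C0 => _ ->. Qed.

Lemma semigroupD t s x : 0 <= t -> 0 <= s -> T (t + s) x = T t (T s x).
Proof. by move=> t0 s0; case: C0 => _ _ -> . Qed.

Definition incr t x := T t x - x.

Lemma incr_strong_cvg0 x e : 0 < e -> \forall s \near 0^'+, N (incr s x) < e.
Proof.
move=> e0; case: C0 => _ _ _ /(_ x) /cvgr0Pnorm_lt /(_ (E e)).
rewrite emb_gt0 => /(_ e0); apply: filterS => s.
by rewrite normr_id (normE E) emb_lt.
Qed.

Lemma incr_linear t : 0 <= t -> linear (incr t).
Proof.
by move=> t0 a x y; rewrite /incr semigroup_linear// scalerBr opprD addrACA.
Qed.

Lemma incr_bounded M t : bounded_by M (T t) -> bounded_by (M + 1) (incr t).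
Proof.
move=> bT x; rewrite (le_trans (ler_rnormB E _ _))// mulrDl mul1r lerD2r.
exact: bT.
Qed.

(** Otherwise T is unbounded along times tending to 0; but along these times
    T t x tends to x, so it is bounded for each x. *)
Lemma semigroup_bounded0 : exists2 d, 0 < d &
  exists2 M, 1 <= M & forall t, 0 <= t <= d -> bounded_by M (T t).
Proof.
apply: contrapT => nb.
have /choice[t tP] n : exists t, 0 <= t <= n.+1%:R^-1 /\ ~ bounded_by n.+1%:R (T t).
  apply: contrapT => nt; apply: nb.
  exists n.+1%:R^-1; first by rewrite invr_gt0.
  exists n.+1%:R; first by rewrite ler1n.
  by move=> t tn; apply: contrapT => bt; apply: nt; exists t.
have t0 n : 0 <= t n by case: (tP n) => /andP[].
have [M bM] : exists M, forall n, bounded_by M (T (t n)).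
  apply: (uniform_boundedness E) => [n|n|x].
  - exact: semigroup_linear.
  - exact/bounded_operator_by/semigroup_op.
  have /right0P[d d0 dP] := incr_strong_cvg0 x 1 ltr01.
  pose n0 := Num.truncn d^-1.
  exists (\sum_(i < n0) N (T (t i) x) + (1 + N x)) => n.
  have S0 : 0 <= \sum_(i < n0) N (T (t i) x) by apply: sumr_ge0 => i _; exact: rnorm_ge0.
  have [nn0|n0n] := ltnP n n0.
    rewrite (bigD1 (Ordinal nn0))//= -addrA lerDl addr_ge0 ?addr_ge0 ?rnorm_ge0//.
    by apply: sumr_ge0 => i _; exact: rnorm_ge0.
  apply: le_trans (_ : 1 + N x <= _); last by rewrite lerDr.
  have [->|tn0] := eqVneq (t n) 0; first by rewrite semigroup0 lerDr.
  rewrite -[T _ x](subrK x) (le_trans (ler_rnormD E _ _))// lerD2r ltW// dP//.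
  rewrite lt_neqAle eq_sym tn0 t0/=.
  case: (tP n) => /andP[_ tn] _; apply: (le_lt_trans tn).
  rewrite -[ltRHS]invrK ltf_pV2 ?posrE ?invr_gt0//.
  apply: lt_le_trans (truncnS_gt _) _.
  by rewrite ler_nat ltnS.
have [_] := tP (Num.truncn M); apply; apply: (bounded_byW E _ _ _ _ (bM _)).
by rewrite ltW// truncnS_gt.
Qed.

Lemma semigroup_iter n t x : 0 <= t -> T (t *+ n) x = iter n (T t) x.
Proof.
move=> t0; elim: n => [|n IH]; first exact: semigroup0.
by rewrite mulrS semigroupD ?mulrn_wge0// IH.
Qed.

Lemma semigroup_bounded U : exists2 M, 1 <= M &
  forall t, 0 <= t <= U -> bounded_by M (T t).
Proof.
have [d d0 [M M1 bM]] := semigroup_bounded0.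
pose n := (Num.truncn (U / d)).+1.
exists (M ^+ n); first exact: exprn_ege1.
move=> t /andP[t0 tU].
have n0 : 0 < n%:R :> R by rewrite ltr0n.
have tn0 : 0 <= t / n%:R by rewrite divr_ge0// ltW.
rewrite -[t](@divfK _ n%:R) ?gt_eqF// mulr_natr => x; rewrite semigroup_iter//.
apply: bounded_by_iter; first exact: le_trans M1.
apply: bM; rewrite tn0/= ler_pdivrMr// (le_trans tU)// -ler_pdivrMl// mulrC.
by rewrite ltW// truncnS_gt.
Qed.

Lemma semigroup_strongly_continuous t x e : 0 <= t -> 0 < e ->
  \forall u \near t, 0 <= u -> N (T u x - T t x) <= e.
Proof.
move=> t0 e0; have [M M1 bM] := semigroup_bounded (t + 1).
have M0 : 0 < M by exact: lt_le_trans M1.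
have /right0P[d d0 dP] := incr_strong_cvg0 x (e / M) (divr_gt0 e0 M0).
have main u v : 0 <= u -> u <= v -> v < u + d -> u <= t + 1 ->
    N (T v x - T u x) <= e.
  move=> u0 uv vd ut; rewrite -[in T v x](subrKC u v).
  rewrite (semigroupD u (v - u)) ?subr_ge0// -linear_B; last exact: semigroup_linear.
  have [->|vu] := eqVneq v u.
    by rewrite subrr semigroup0 subrr linear_0 ?rnorm0 ?ltW//; exact: semigroup_linear.
  apply: (le_trans (bM u _ _)); first by rewrite u0.
  rewrite mulrC -ler_pdivlMr// ltW// dP// subr_gt0 lt_neqAle eq_sym vu uv/=; lra.
near=> u => u0; have [ut|tu] := leP t u.
  apply: main => //; last by lra.
  by near: u; apply: lt_nbhsl; lra.
rewrite rnorm_distC; apply: main => //; [exact: ltW| |lra].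
rewrite -ltrBlDr; near: u; apply: lt_nbhsr; lra.
Unshelve. all: by end_near. Qed.

Lemma incr_iter_strongly_continuous m t x e : 0 <= t -> 0 < e ->
  \forall u \near t, 0 <= u -> N (iter m (incr u) x - iter m (incr t) x) <= e.
Proof.
move=> t0; have [M M1 bM] := semigroup_bounded (t + 1).
elim: m e => [|m IH] e e0; first apply: (@nearW _ (nbhs t)) => u _.
  by rewrite subrr rnorm0 ltW.
have M0 : 0 < M + 1 by lra.
have e1 : 0 < e / 2 / (M + 1) by rewrite !divr_gt0.
have e2 : 0 < e / 2 by lra.
have yz_near := IH _ e1.
have uz_near := semigroup_strongly_continuous t (iter m (incr t) x) (e / 2) t0 e2.
near=> u => u0.
have : N (iter m (incr u) x - iter m (incr t) x) <= e / 2 / (M + 1).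
  by move: u0; near: u; exact: yz_near.
have : N (T u (iter m (incr t) x) - T t (iter m (incr t) x)) <= e / 2.
  by move: u0; near: u; exact: uz_near.
rewrite !iterS; set y := iter m (incr u) x; set z := iter m (incr t) x => uz yz.
rewrite (le_trans (ler_rnorm_dist E (incr u z) _ _))// -linear_B; last exact: incr_linear.
have -> : incr u z - incr t z = T u z - T t z by rewrite /incr opprB addrA subrK.
have ut : u <= t + 1 by apply: ltW; near: u; apply: lt_nbhsl; lra.
have := incr_bounded M u (bM u _) (y - z); rewrite u0 ut => /(_ isT).
by move: yz; rewrite ler_pdivlMr//; lra.
Unshelve. all: by end_near. Qed.

(** The binomial expansion of (T(t) - I)^m. Only the coefficient of I matters
    later, hence the other coefficients are left unspecified. *)
Lemma incr_iter_expand m : exists c : nat -> K, forall t x, 0 <= t ->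
  iter m (incr t) x = (-1) ^+ m *: x + \sum_(j < m) c j *: T (t *+ j.+1) x.
Proof.
elim: m => [|m [c IH]].
  by exists (fun=> 0) => t x t0; rewrite big_ord0 expr0 scale1r addr0.
pose c' j := (if j is j'.+1 then c j' else (-1) ^+ m) - (if (j < m)%N then c j else 0).
exists c' => t x t0; rewrite iterS IH// /incr linear_D; last exact: semigroup_linear.
rewrite linear_Z; last exact: semigroup_linear.
rewrite linear_sum; last exact: semigroup_linear.
under [X in _ = _ + X]eq_bigr do rewrite /c' scalerBl.
rewrite sumrB big_ord_recl /= [X in _ = _ + (_ - X)]big_ord_recr /= ltnn scale0r addr0.
rewrite mulr1n exprS mulN1r scaleNr opprD addrCA; congr (_ + (_ + _ - _)).
  apply: eq_bigr => j _.
  by rewrite linear_Z; [rewrite -semigroupD ?mulrn_wge0// -mulrS|exact: semigroup_linear].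
by apply: eq_bigr => j _; rewrite ltn_ord.
Qed.

End Semigroup.
(** * From averages to a norm estimate *)

Section Averaging.
Context {R : realType} {K : numFieldType} (E : real_part R K).
Context {X : completeNormedModType K}.
Local Notation N := (rnorm E).
Local Notation bounded_by := (bounded_by E).
Context (T : R -> X -> X) (C0 : C0_semigroup T).
Implicit Types (s t u v e : R) (x y z : X).
Local Notation B := (incr T).

(** Averaging B(s) B(t)^m over t in [a, b] kills all terms of its expansion but
    (-1)^m B(s). The times are t_k = a + k u with u = s / m!, so that for every
    j from 1 to m the times j t_k form a progression of which s is an integer
    multiple of the step, and B(s) T(j t_k) telescopes. The error is of order
    Q / n, with n the number of times and Q independent of s. *)
Lemma incr_bounded_of_average m a b g e : 0 <= a -> a < b -> 0 < e ->
  (\forall s \near 0^'+, forall t x, a <= t <= b ->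
    N (B s (iter m (B t) x)) <= g * N x) ->
  \forall s \near 0^'+, bounded_by (g + e) (B s).
Proof.
move=> a0 ab e0 gB; have [M M1 bM] := semigroup_bounded E T C0 (m%:R * b + 1).
have [c cE] := incr_iter_expand T C0 m.
(* For each j, the telescoped sum is at most 2 q M, where q = m! / j. *)
pose Q := \sum_(j < m) N (c j) * (m`!%:R * (2 * M)).
pose n := (Num.truncn (Q / e)).+1.
have Qn : Q <= n%:R * e by rewrite -ler_pdivrMr// ltW// truncnS_gt.
have n0 : 0 < n%:R :> R by rewrite ltr0n.
have f0 : 0 < m`!%:R :> R by rewrite ltr0n fact_gt0.
have d0 : 0 < (b - a) / n%:R by rewrite divr_gt0// subr_gt0.
near=> s => x.
have s0 : 0 < s by near: s; exact: nbhs_right_gt.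
have s1 : s < 1 by near: s; exact: nbhs_right_lt.
have sn : s < (b - a) / n%:R by near: s; exact: nbhs_right_lt.
have gs t z : a <= t <= b -> N (B s (iter m (B t) z)) <= g * N z.
  by move: t z; near: s.
pose u := s / m`!%:R; pose t k := a + k%:R * u.
have u0 : 0 <= u by rewrite divr_ge0// ltW.
have us : u <= s by rewrite ler_pdivrMr// ler_peMr ?ler1n ?fact_gt0// ltW.
have t0 k : 0 <= t k by rewrite addr_ge0// mulr_ge0.
have tb k : (k <= n)%N -> t k <= b.
  move=> kn; rewrite /t -lerBrDl; move: sn; rewrite ltr_pdivlMr// => sn.
  have : k%:R <= n%:R :> R by rewrite ler_nat.
  by have : 0 <= k%:R :> R by []; nra.
have expand k : B s (iter m (B (t k)) x) =
    (-1) ^+ m *: B s x + \sum_(j < m) c j *: B s (T (t k *+ j.+1) x).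
  have lB := incr_linear T C0 s (ltW s0).
  rewrite cE// linear_D// linear_Z// linear_sum//; congr (_ + _).
  by apply: eq_bigr => j _; rewrite linear_Z.
have inner (j : 'I_m) :
    N (\sum_(k < n) B s (T (t k *+ j.+1) x)) <= m`!%:R * (2 * M) * N x.
  pose q := (m`! %/ j.+1)%N.
  have qj : (q * j.+1)%N = m`! by rewrite divnK// dvdn_fact//= ltn_ord.
  pose f k := T (t k *+ j.+1) x.
  have suq : s = u *+ j.+1 *+ q.
    by rewrite -mulrnA mulnC qj -[RHS]mulr_natr divfK// gt_eqF.
  have fq k : B s (T (t k *+ j.+1) x) = f (k + q)%N - f k.
    rewrite /incr -semigroupD ?mulrn_wge0 ?(ltW s0)//; congr (T _ x - _).
    by rewrite /t suq natrD; ring.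
  under eq_bigr do rewrite fq.
  rewrite sum_shift_diff (le_trans (ler_rnorm_sum E _ _ _ _))//.
  have bf i : (i < n + q)%N -> N (f i) <= M * N x.
    move=> inq; apply: bM; rewrite mulrn_wge0//=.
    have jm : j.+1%:R <= m%:R :> R by rewrite ler_nat ltn_ord.
    have iR : i%:R <= n%:R + q%:R :> R by rewrite -natrD ler_nat ltnW.
    have tbn := tb n (leqnn n); rewrite /t in tbn.
    have uq : u * j.+1%:R * q%:R = s.
      by rewrite [RHS]suq -[RHS]mulr_natr -[in RHS]mulr_natr.
    have b0 : 0 <= b by lra.
    rewrite -[t i *+ _]mulr_natr /t.
    have h1 : (a + n%:R * u) * j.+1%:R <= b * m%:R.
      by apply: ler_pM => //; rewrite addr_ge0// mulr_ge0.
    have h2 : (i%:R * u) * j.+1%:R <= (n%:R + q%:R) * u * j.+1%:R.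
      by rewrite !ler_wpM2r.
    have -> : m%:R * b + 1 = b * m%:R + 1 by ring.
    apply: le_trans (_ : (a + n%:R * u) * j.+1%:R + s <= _); last first.
      by apply: lerD => //; exact: ltW.
    rewrite -uq; move: h2; lra.
  apply: le_trans (_ : \sum_(i < q) 2 * M * N x <= _).
    apply: ler_sum => i _; rewrite (le_trans (ler_rnormB E _ _))//.
    have := bf (n + i)%N; rewrite ltn_add2l ltn_ord => /(_ isT).
    have := bf i; rewrite (leq_trans (ltn_ord i) (leq_addl _ _)) => /(_ isT).
    by lra.
  rewrite sumr_const card_ord -mulrnAl -mulr_natl -!mulrA ler_wpM2r//.
    by rewrite !mulr_ge0 ?rnorm_ge0//; lra.
  by rewrite ler_nat -qj leq_pmulr.
have total : n%:R * N (B s x) <= n%:R * (g * N x) + Q * N x.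
  have Nn : N (n%:R : K) = n%:R by rewrite -(rmorph_nat E) rnorm_emb.
  have sum_expand : \sum_(k < n) B s (iter m (B (t k)) x) =
      n%:R *: ((-1) ^+ m *: B s x) +
      \sum_(j < m) c j *: \sum_(k < n) B s (T (t k *+ j.+1) x).
    under eq_bigr do rewrite expand.
    rewrite big_split sumr_const card_ord scaler_nat exchange_big /=.
    by congr (_ + _); apply: eq_bigr => j _; rewrite scaler_sumr.
  have -> : n%:R * N (B s x) = N (n%:R *: ((-1) ^+ m *: B s x)).
    by rewrite rnormZ Nn /rnorm normrZ normrX normrN1 expr1n mul1r.
  rewrite -[_ *: _](addrK (\sum_(j < m) c j *: \sum_(k < n) B s (T (t k *+ j.+1) x))).
  rewrite -sum_expand (le_trans (ler_rnormB E _ _))// lerD//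
    (le_trans (ler_rnorm_sum E _ _ _ _))//.
    apply: le_trans (_ : \sum_(k < n) g * N x <= _).
      by apply: ler_sum => k _; rewrite gs// tb ?andbT// /t ?lerDl ?mulr_ge0// ltnW.
    by rewrite sumr_const card_ord mulr_natl.
  rewrite /Q mulr_suml; apply: ler_sum => j _.
  by rewrite rnormZ -mulrA ler_wpM2l ?rnorm_ge0.
rewrite -(ler_pM2l n0) (le_trans total)//.
have := rnorm_ge0 E x; nra.
Unshelve. all: by end_near. Qed.

End Averaging.
(** * The contraction step *)

Definition scalar_plus_power_compact {R : realType} {K : numFieldType}
    (E : real_part R K) {X : normedModType K} (T : R -> X -> X) m (h t : R) :=
  exists a S, [/\ rnorm E (a - 1) <= h, (forall x, T t x = a *: x + S x) &
    compact_operators X (iter m S)].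

Section Lotz.
Context {R : realType} {K : numFieldType} (E : real_part R K).
Context {X : completeNormedModType K}.
Local Notation N := (rnorm E).
Local Notation bounded_by := (bounded_by E).
Context (T : R -> X -> X) (C0 : C0_semigroup T).
Implicit Types (s t u v e : R) (x y z : X).
Local Notation B := (incr T).

Lemma compact_operators_scale (A : X -> X) (c : K) : compact_operators X A ->
  compact_operators X (fun x => c *: A x).
Proof.
move=> [bA cA]; split.
  have [k k0 bk] := bounded_operator_by E A bA.
  have [lA _] := bA.
  apply: (bounded_by_operator E (N c * k)).
    by move=> a x y; rewrite lA scalerDr !scalerA mulrC.
  by move=> x; rewrite rnormZ -mulrA ler_wpM2l ?rnorm_ge0.
have [U AU [cU _]] := cA.
have cZ : compact ((fun y : X => c *: y) @` U).
  apply: continuous_compact => //.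
  by apply: continuous_subspaceT => y; exact: scaler_continuous.
exists ((fun y : X => c *: y) @` U); last first.
  by split=> //; apply: compact_closed => //; exact: norm_hausdorff.
by move=> _ [x x1 <-]; exists (A x) => //; apply: AU; exists x.
Qed.

Lemma iter_scale (A : X -> X) (c : K) n : linear A ->
  iter n (fun x => c *: A x) = (fun x => c ^+ n *: iter n A x).
Proof.
move=> lA; apply/funext => x; elim: n => [|n IH]; first by rewrite expr0 scale1r.
by rewrite !iterS IH linear_Z// scalerA exprS.
Qed.

Lemma incr_comp_compact_small (A : X -> X) e : compact_operators X A -> 0 < e ->
  \forall s \near 0^'+, forall x, N (B s (A x)) <= e * N x.
Proof.
move=> [bA cA] e0; have [M M1 bM] := semigroup_bounded E T C0 1.
have [U AU [cU _]] := cA.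
have near_lin : \forall s \near 0^'+, linear (B s) /\ bounded_by (M + 1) (B s).
  near=> s; have s0 : 0 <= s by near: s; exact: nbhs_right_ge.
  split; first exact: incr_linear.
  apply: incr_bounded; apply: bM; rewrite s0/=.
  by near: s; apply: nbhs_right_le.
have BU : \forall s \near 0^'+, forall y, U y -> N (B s y) <= e.
  apply: (uniform_on_compact E _ _ _ (M + 1)) => // y e' e'0.
  by apply: filterS (incr_strong_cvg0 E T C0 y e' e'0) => s /ltW.
near=> s => x.
have s0 : 0 <= s by near: s; exact: nbhs_right_ge.
have [lA _] := bA; have lB := incr_linear T C0 s s0.
have lBA : linear (fun y => B s (A y)) by move=> a y z; rewrite lA lB.
apply: (ball_bounded_by E e _ lBA) => {}x /(unit_ballE E) x1.
have : forall y, U y -> N (B s y) <= e by near: s.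
by apply; apply: AU; exists x.
Unshelve. all: by end_near. Qed.

(** Of the 7/8 b, a part 1/4 b accounts for B(s) S(t)^m, a part 1/2 b for
    replacing S(t)^m by B(t)^m, and a part 1/8 b for the averaging error. *)
Lemma incr_contraction m b :
  (forall h, 0 < h -> exists2 d, 0 < d & forall t, 0 < t < d ->
    scalar_plus_power_compact E T m h t) -> 0 < b ->
  (\forall s \near 0^'+, bounded_by b (B s)) ->
  \forall s \near 0^'+, bounded_by (7 / 8 * b) (B s).
Proof.
move=> TS b0 bb; have [M M1 bM] := semigroup_bounded E T C0 1.
pose C := m%:R * (M + 2) ^+ m : R.
have C_ge0 : 0 <= C by rewrite mulr_ge0// exprn_ge0; lra.
have C1 : 0 < 2 * (C + 1) by lra.
(* C is the constant of [iter_perturb]; this h makes the perturbation of the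
   m-th power at most 1/2. *)
pose h := (2 * (C + 1))^-1.
have h0 : 0 < h by rewrite invr_gt0.
have hC : h * (2 * (C + 1)) = 1 by rewrite mulVf// gt_eqF.
have h1 : h <= 1 by rewrite invf_le1; lra.
have [d d0 dP] := TS h h0.
pose w := Num.min d 1 / 2.
have wd : w < d by have : Num.min d 1 <= d by [rewrite ge_min lexx]; rewrite /w; lra.
have w1 : w < 1.
  by have : Num.min d 1 <= 1 by [rewrite ge_min lexx orbT]; rewrite /w; lra.
have w0 : 0 < w by rewrite divr_gt0// lt_min d0 ltr01.
have eventually t : 0 < t < d -> t < 1 ->
    \forall s \near 0^'+, forall x, N (B s (iter m (B t) x)) <= 3 / 4 * b * N x.
  move=> td t1; have [a [S [ah TE cS]]] := dP t td.
  have t0 : 0 <= t by lra.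
  have b4 : 0 < b / 4 by lra.
  have SB := incr_comp_compact_small _ _ cS b4.
  near=> s => x.
  have s0 : 0 <= s by near: s; exact: nbhs_right_ge.
  have bBs : bounded_by b (B s) by near: s.
  have cs : forall x, N (B s (iter m S x)) <= b / 4 * N x by near: s.
  have SE y : S y = (1 - a) *: y + B t y.
    by rewrite /incr TE scalerBl scale1r -[_ + S y - y]addrA subrKA subrKC.
  have pert : N (iter m S x - iter m (B t) x) <= C * h * N x.
    rewrite /C (_ : M + 2 = (M + 1) + 1); last by ring.
    apply: (iter_perturb E (M + 1) h m _ _ (1 - a)) => //; first by lra.
    - exact: incr_linear.
    - by apply: incr_bounded; apply: bM; lra.
    - by rewrite rnorm_distC.
  have lB := incr_linear T C0 s s0.
  have := ler_rnormB E (B s (iter m S x)) (B s (iter m S x - iter m (B t) x)).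
  rewrite [B s (iter m S x - _)]linear_B// subKr.
  have := cs x; have := bBs (iter m S x - iter m (B t) x); rewrite linear_B//.
  have : b * N (iter m S x - iter m (B t) x) <= b * (1 / 2 * N x).
    apply: ler_wpM2l; first exact: ltW.
    rewrite (le_trans pert)// ler_wpM2r ?rnorm_ge0//; lra.
  lra.
(* Baire: the threshold for s can be chosen uniformly in t on a segment. It is
   searched in [w / 2, w], away from 0 and within the range of [eventually]. *)
have [n [p [q [wp pq qw npq]]]] : exists n p q, [/\ w / 2 <= p, p < q, q <= w &
    forall t, p <= t <= q -> forall s, 0 < s < n.+1%:R^-1 -> forall x,
      N (B s (iter m (B t) x)) <= 3 / 4 * b * N x].
  apply: (@baire_segment R (w / 2) w (fun n t => forall s, 0 < s < n.+1%:R^-1 ->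
    forall x, N (B s (iter m (B t) x)) <= 3 / 4 * b * N x)); first by lra.
    move=> n t tcl.
    have tw : w / 2 <= t <= w.
      have : closure `[w / 2, w]%classic t.
        by apply: closureS tcl => u [uw _]; rewrite /= in_itv.
      by rewrite -(closure_id _).1 /= ?in_itv//; exact: interval_closed.
    split=> // s sn x; apply/ler_addgt0Pr => e e0.
    have s0 : 0 <= s by lra.
    have [L L1 bL] := semigroup_bounded E T C0 s.
    have bBs : bounded_by (L + 1) (B s) by apply: incr_bounded; apply: bL; lra.
    have L0 : 0 < L + 1 by lra.
    have t0 : 0 <= t by lra.
    have [u [[uw uP] ut]] := tcl _
      (incr_iter_strongly_continuous E T C0 m t x _ t0 (divr_gt0 e0 L0)).
    have lB := incr_linear T C0 s s0.
    have := bBs (iter m (B u) x - iter m (B t) x); rewrite linear_B//.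
    have := ler_rnormB E (B s (iter m (B u) x))
      (B s (iter m (B u) x) - B s (iter m (B t) x)).
    rewrite subKr; have := uP s sn x.
    have : N (iter m (B u) x - iter m (B t) x) <= e / (L + 1) by apply: ut; lra.
    by rewrite ler_pdivlMr//; lra.
  move=> t tw; have /right0P[r r0 rP] := eventually t ltac:(lra) ltac:(lra).
  exists (Num.truncn r^-1) => s /andP[s0 sn]; apply: rP; rewrite s0/=.
  apply: (lt_trans sn); rewrite -[ltRHS]invrK ltf_pV2 ?posrE ?invr_gt0//.
  exact: truncnS_gt.
rewrite (_ : 7 / 8 * b = 3 / 4 * b + b / 8); last by field.
apply: (incr_bounded_of_average E T C0 m p q) => //; [lra|lra|].
near=> s => t x tpq; apply: npq => //; apply/andP; split; near: s.
  exact: nbhs_right_gt.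
by apply: nbhs_right_lt; rewrite invr_gt0.
Unshelve. all: by end_near. Qed.

End Lotz.
(** * Proof of the theorem *)

Section Conclusion.
Context {R : realType} {K : numFieldType} (E : real_part R K).
Context {X : completeNormedModType K}.
Local Notation N := (rnorm E).
Local Notation bounded_by := (bounded_by E).
Context (T : R -> X -> X) (C0 : C0_semigroup T).
Implicit Types (s t u v e : R) (x y z : X).
Local Notation B := (incr T).

Lemma semigroup_uniformly_continuous m :
  (forall h, 0 < h -> exists2 d, 0 < d & forall t, 0 < t < d ->
    scalar_plus_power_compact E T m h t) ->
  uniformly_continuous_semigroup T.
Proof.
move=> TS; have [M M1 bM] := semigroup_bounded E T C0 1.
have bounds k : \forall s \near 0^'+, bounded_by ((7 / 8) ^+ k * (M + 1)) (B s).
  elim: k => [|k IH].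
    near=> s; rewrite expr0 mul1r; apply: incr_bounded; apply: bM.
    by apply/andP; split; near: s; [exact: nbhs_right_ge|exact: nbhs_right_le].
  rewrite exprS -mulrA; apply: (incr_contraction E T C0 m) => //.
  by rewrite mulr_gt0 ?exprn_gt0//; lra.
apply/cvgr0Pnorm_lt => e e0.
have e0' := re_gt0 E e e0.
have M0 : 0 < M + 1 by lra.
have [k ke] : exists k, (7 / 8) ^+ k * (M + 1) < re E e.
  have d0 : 0 < re E e / (M + 1) by rewrite divr_gt0.
  have /cvgr0Pnorm_lt/(_ _ d0)[k _ /(_ k (leqnn k))] :
      (7 / 8 : R) ^+ n @[n --> \oo] --> (0 : R).
    by apply: cvg_expr; rewrite ger0_norm; lra.
  move=> /= h; exists k; rewrite -ltr_pdivlMr//.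
  by apply: le_lt_trans h; exact: ler_norm.
near=> s.
have k0 : 0 <= (7 / 8) ^+ k * (M + 1) by rewrite mulr_ge0 ?exprn_ge0//; lra.
have /andP[n0 nk] : 0 <= opnorm (B s) <= E ((7 / 8) ^+ k * (M + 1)).
  by apply: opnorm_bounds => //; near: s.
rewrite ger0_norm// (le_lt_trans nk)// -(emb_re E e (ltW e0)).
by rewrite emb_lt.
Unshelve. all: by end_near. Qed.

(** If a(t_n) stayed away from 1 for some t_n tending to 0, then the powers of
    I + (1 - a(t_n))^-1 B(t_n) would be compact approximations of I. *)
Lemma coefficient_cvg1 m : ~ BCAP X ->
  (forall t, 0 <= t -> exists a S, [/\ forall x, T t x = a *: x + S x,
     linear S & compact_operators X (iter m S)]) ->
  forall h, 0 < h -> exists2 d, 0 < d & forall t, 0 < t < d ->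
    scalar_plus_power_compact E T m h t.
Proof.
move=> nBCAP TS h h0; apply: contrapT => nd; apply: nBCAP.
have /choice[p pP] n : exists p : R * K * (X -> X), let: (t, a, V) := p in
    [/\ 0 < t < n.+1%:R^-1, h < N (a - 1), (forall x, T t x = a *: x + V x),
      linear V & compact_operators X (iter m V)].
  apply: contrapT => nt; apply: nd; exists n.+1%:R^-1 => [|t tn].
    by rewrite invr_gt0.
  have [a [S [TE lS cS]]] := TS t (ltac:(lra)).
  exists a, S; split=> //; rewrite leNgt; apply/negP => ha.
  by apply: nt; exists (t, a, S).
have [M M1 bM] := semigroup_bounded E T C0 1.
pose k := 1 + h^-1 * (M + 1).
have hV : 0 < h^-1 by rewrite invr_gt0.
have k1 : 1 <= k by rewrite lerDl mulr_ge0//; lra.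
pose b n := (1 - (p n).1.2)^-1; pose t n := (p n).1.1.
pose A n y := y + b n *: B (t n) y.
have facts n : [/\ 0 < t n < n.+1%:R^-1, N (b n) <= h^-1, linear (A n),
    bounded_by k (A n) & compact_operators X (iter m (A n))].
  have := pP n; rewrite /A /b /t; case: (p n) => [[u a] S] /= [un ha TE lS cS].
  have u1 : 0 <= u <= 1.
    case/andP: un => u0 un; rewrite ltW//= (le_trans (ltW un))//.
    by rewrite invf_le1 ?ler1n.
  have Na : 0 < N (1 - a) by rewrite rnorm_distC (lt_trans h0).
  have a1 : 1 - a != 0 by rewrite -(rnorm_eq0 E) gt_eqF.
  have bh : N (1 - a)^-1 <= h^-1.
    by rewrite rnormV lef_pV2 ?posrE// rnorm_distC ltW.
  (* This identity exhibits the operator both as near I and as a multiple of S. *)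
  have AE : (fun y => y + (1 - a)^-1 *: B u y) = (fun y => (1 - a)^-1 *: S y).
    apply/funext => y; rewrite -[X in X + _](scalerK a1) -scalerDr; congr (_ *: _).
    by rewrite /incr TE scalerBl scale1r -[_ + S y - y]addrA subrKA subrKC.
  split=> //.
  - by rewrite AE => c x y; rewrite lS scalerDr !scalerA mulrC.
  - move=> x; rewrite (le_trans (ler_rnormD E _ _))// mulrDl mul1r lerD2l rnormZ -mulrA.
    by apply: ler_pM; rewrite ?rnorm_ge0//; exact: incr_bounded (bM u u1) x.
  - by rewrite AE iter_scale//; exact: (compact_operators_scale E).
have k0 : 0 <= k by lra.
have k_m : 1 <= k ^+ m by exact: exprn_ege1.
exists (E (k ^+ m)); split; first by rewrite -(rmorph1 E) emb_le.
move=> D e cD e0.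
have e2 : 0 < re E e / 2 by rewrite divr_gt0// re_gt0.
have [n nD] : exists n, forall x, D x -> N (iter m (A n) x - x) <= re E e / 2.
  have : \forall n \near \oo, forall x, D x -> N (iter m (A n) x - x) <= re E e / 2.
    apply: (uniform_on_compact E _ _ (fun n x => iter m (A n) x - x) (k ^+ m + 1)) => //.
      near=> n; have [_ _ lA bA _] := facts n; split.
        move=> c x y; rewrite (linear_iter _ _ lA) scalerBr opprD.
        by rewrite addrACA.
      move=> x; rewrite (le_trans (ler_rnormB E _ _))// mulrDl mul1r lerD2r.
      exact: bounded_by_iter.
    move=> x e' e'0.
    pose c := m%:R * k ^+ m * h^-1 + 1.
    have c0 : 0 < c by rewrite ltr_wpDl// !mulr_ge0 ?exprn_ge0// ltW.
    have /right0P[d d0 dP] := incr_strong_cvg0 E T C0 x (e' / c) (divr_gt0 e'0 c0).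
    near=> n; have [tn bn lA bA _] := facts n.
    rewrite (le_trans (iter_near_id E k m _ _ k1 lA bA))//.
    rewrite /A addrC addKr rnormZ.
    have tnd : 0 < t n < d.
      case/andP: tn => -> /lt_trans -> //.
      by near: n; exact: near_infty_natSinv_lt (PosNum d0).
    have := dP _ tnd; rewrite ltr_pdivlMr// => he'.
    apply: le_trans (ltW he'); rewrite mulrA mulrC ler_wpM2l ?rnorm_ge0//.
    apply: le_trans (_ : m%:R * k ^+ m * h^-1 <= _); last by rewrite lerDl.
    by rewrite ler_wpM2l// mulr_ge0// exprn_ge0.
  by case=> n _ /(_ n (leqnn n)); exists n.
have [_ _ lA bA cA] := facts n.
exists (iter m (A n)); split => //.
  have := opnorm_bounds E (k ^+ m) (iter m (A n)) (exprn_ge0 _ k0)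
    (bounded_by_iter E k _ m k0 bA).
  by case/andP.
have : 0 <= supremum 0 [set `|iter m (A n) x - x| | x in D] <= E (re E e / 2).
  apply: supremum_emb_bounds; first exact: ltW.
  by move=> _ [x Dx <-]; rewrite normr_ge0 (normE E) emb_le nD.
case/andP=> _ /le_lt_trans -> //; rewrite -[ltRHS](emb_re E e (ltW e0)) emb_lt.
have := re_gt0 E e e0; lra.
Unshelve. all: by end_near. Qed.

End Conclusion.

Lemma lotz_of_real_part (R : realType) (K : numFieldType) (E : real_part R K)
    (X : completeNormedModType K) m :
  bounded_operators X =
    [set (fun x : X => a *: x + S x) |
      a in [set: K] & S in strictly_singular_operators X] ->
  (forall S : X -> X, strictly_singular_operators X S ->
    compact_operators X (iter m S)) ->
  ~ BCAP X -> Lotz_property R X.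
Proof.
move=> decomp SSm nBCAP T C0; apply: (semigroup_uniformly_continuous E T C0 m).
apply: (coefficient_cvg1 E T C0) => // t t0.
have : bounded_operators X (T t) by exact: semigroup_op.
rewrite decomp => -[a _ [S SS TE]]; exists a, S; split=> [x| |].
- by rewrite -TE.
- by case: SS => -[].
- exact: SSm.
Qed.

Definition real_part_id (R : realType) : real_part R R.
Proof. by apply: (@RealPart R R idfun idfun). Defined.

Definition real_part_complex (R : realType) : real_part R R[i].
Proof.
apply: (@RealPart R R[i] (real_complex R) (@complex.Re R)) => [x y|z z0].
  exact: lecR.
by apply: RRe_real; exact: ger0_real.
Defined.

Theorem corollary4p2 (R : realType) :
  (forall (X : completeNormedModType R) (m : nat),
     bounded_operators X =
       [set (fun x : X => a *: x + S x) |
         a in [set: R] & S in strictly_singular_operators X] ->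
     (0 < m)%N ->
     (forall S : X -> X, strictly_singular_operators X S ->
        compact_operators X (iter m S)) ->
     ~ BCAP X -> Lotz_property R X) /\
  (forall (X : completeNormedModType R[i]) (m : nat),
     bounded_operators X =
       [set (fun x : X => a *: x + S x) |
         a in [set: R[i]] & S in strictly_singular_operators X] ->
     (0 < m)%N ->
     (forall S : X -> X, strictly_singular_operators X S ->
        compact_operators X (iter m S)) ->
     ~ BCAP X -> Lotz_property R X).
Proof.
split=> X m decomp _; first exact: (lotz_of_real_part _ _ (real_part_id R)).
exact: (lotz_of_real_part _ _ (real_part_complex R)).
Qed.
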